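(* Let $\bar\psi\in\mathcal{C}(\mathbb{X})$. Then $\bar\psi$ is a fixed point of $\hat{T}$ (i.e. $\hat T\bar\psi=\bar\psi$) if and only if there exists $c\in\mathbb{R}$ such that $T\bar\psi=\bar\psi+c$. Likewise, $\bar\psi$ is a fixed point of $\check{T}$ (i.e. $\check T\bar\psi=\bar\psi$) if and only if there exists $c\in\mathbb{R}$ such that $T\bar\psi=\bar\psi+c$.
   Context: Setting. $\mathbb{X}\subset\mathbb{R}^n$ is a nonempty compact set, $\mathbb{Z}\subset\mathbb{X}\times\mathbb{R}^m$ is compact, $f:\mathbb{Z}\to\mathbb{X}$ and $\ell:\mathbb{Z}\to\mathbb{R}$ are continuous. For $x\in\mathbb{X}$, $\mathbb{U}(x):=\{u\in\mathbb{R}^m:(x,u)\in\mathbb{Z}\}$ is nonempty, and $f(x,u)\in\mathbb{X}$ for all $u\in\mathbb{U}(x)$; the set-valued map $\mathbb{U}(\cdot)$ is upper semicontinuous. $\mathcal{C}(\mathbb{X})$ is the set of continuous functions $\mathbb{X}\to\mathbb{R}$. Operators. $T\psi(x):=\min_{u\in\mathbb{U}(x)}[\ell(x,u)+\psi(f(x,u))]$; it is a standing assumption that $T$ maps $\mathcal{C}(\mathbb{X})$ into $\mathcal{C}(\mathbb{X})$. For $\psi_1,\psi_2\in\mathcal{C}(\mathbb{X})$, $c(\psi_1,\psi_2):=\frac12\max_{x\in\mathbb{X}}[\psi_1(x)-\psi_2(x)]+\frac12\min_{x\in\mathbb{X}}[\psi_1(x)-\psi_2(x)]$. The min-shifted and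 max-shifted Bellman operators $\hat T,\check T:\mathcal{C}(\mathbb{X})\to\mathcal{C}(\mathbb{X})$ are $\hat{T}\psi:=\min\{\psi,\,T\psi+c(\psi,T\psi)\}$ and $\check{T}\psi:=\max\{\psi,\,T\psi+c(\psi,T\psi)\}$ (pointwise minimum and maximum). The equation $T\bar\psi=\bar\psi+c$ is called the shifted Bellman Equation. *)

(* Defs.v *)
From mathcomp Require Import all_boot all_order all_algebra.
From mathcomp Require Import all_classical all_reals all_analysis.
Set Implicit Arguments.
Unset Strict Implicit.
Unset Printing Implicit Defensive.
Import Order.TTheory GRing.Theory Num.Theory.
Import numFieldNormedType.Exports.
Local Open Scope classical_set_scope.
Local Open Scope ring_scope.

(* Functions on X (resp. Z) are represented by total functions of which only
   the values on X (resp. Z) matter: C(X) is [continuous_on X], and equality in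
   C(X) is equality at every point of X. *)

(* The least and greatest elements of A; junk value 0 when there is none. *)
Definition set_min (R : realType) (A : set R) : R :=
  xget 0 [set y | A y /\ forall z, A z -> y <= z].

Definition set_max (R : realType) (A : set R) : R :=
  xget 0 [set y | A y /\ forall z, A z -> z <= y].

Lemma set_minE (R : realType) (A : set R) (y : R) :
  A y -> (forall z, A z -> y <= z) -> set_min A = y.
Proof.
move=> Ay yA; apply: xget_unique => // z [Az zA].
by apply/eqP; rewrite eq_le zA // yA.
Qed.

Lemma set_maxE (R : realType) (A : set R) (y : R) :
  A y -> (forall z, A z -> z <= y) -> set_max A = y.
Proof.
move=> Ay yA; apply: xget_unique => // z [Az zA].
by apply/eqP; rewrite eq_le zA // yA.
Qed.

Definition continuous_on (S : topologicalType) (R : realType) (X : set S)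
  (psi : S -> R) : Prop := {within X, continuous psi}.

Definition upper_semicontinuous_map (S V : topologicalType) (X : set S)
    (U : S -> set V) : Prop :=
  forall x, X x -> forall O : set V, open O -> U x `<=` O ->
    \forall y \near within X (nbhs x), U y `<=` O.

Section Bellman.
Variables (R : realType) (n m : nat).
Variables (X : set 'rV[R]_n) (Z : set ('rV[R]_n * 'rV[R]_m)).
Variables (f : 'rV[R]_n * 'rV[R]_m -> 'rV[R]_n) (l : 'rV[R]_n * 'rV[R]_m -> R).
Implicit Types psi : 'rV[R]_n -> R.

Definition control_set (x : 'rV[R]_n) : set 'rV[R]_m := [set u | Z (x, u)].

Definition bellman psi : 'rV[R]_n -> R := fun x =>
  set_min [set l (x, u) + psi (f (x, u)) | u in control_set x].

Definition shift_const psi1 psi2 : R :=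
  2^-1 * set_max [set psi1 x - psi2 x | x in X] +
  2^-1 * set_min [set psi1 x - psi2 x | x in X].

Definition min_shifted_bellman psi : 'rV[R]_n -> R := fun x =>
  Num.min (psi x) (bellman psi x + shift_const psi (bellman psi)).

Definition max_shifted_bellman psi : 'rV[R]_n -> R := fun x =>
  Num.max (psi x) (bellman psi x + shift_const psi (bellman psi)).

Definition is_fixed_point (F : ('rV[R]_n -> R) -> ('rV[R]_n -> R)) psi : Prop :=
  forall x, X x -> F psi x = psi x.

Definition shifted_bellman_eq psi (c : R) : Prop :=
  forall x, X x -> bellman psi x = psi x + c.

End Bellman.

(* Main.v *)
Require Import Defs.
From mathcomp Require Import all_boot all_order all_algebra.
From mathcomp Require Import all_classical all_reals all_analysis.
From mathcomp Require Import lra.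
Import Order.TTheory GRing.Theory Num.Theory.
Import numFieldNormedType.Exports.
Local Open Scope classical_set_scope.
Local Open Scope ring_scope.

(** With [g := psi - T psi] on [X], the shift constant [c(psi, T psi)] is the
    midpoint of the range of [g]. Being a fixed point of the min-shifted
    operator means [psi <= T psi + c(psi, T psi)], that is, [g] never exceeds
    the midpoint of its range. By compactness [g] attains its maximum, which is
    then at most the mean of its maximum and its minimum; so the two extrema
    agree and [g] is constant on [X], which is the shifted Bellman equation
    (with the constant [- c(psi, T psi)]). The max-shifted operator asks that
    [g] never be below the midpoint, and the same argument applies at a minimum
    point ([le_shift_const_eq] and [ge_shift_const_eq]). Conversely, if [g] is
    constant then the midpoint is that constant, so [T psi + c(psi, T psi)]
    is [psi] itself and both operators fix [psi]. *)

Set Implicit Arguments.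
Unset Strict Implicit.

(** By the extreme value theorem, the [set_max] and [set_min] in
    [shift_const] are genuine extrema rather than default values. *)
Lemma shift_const_midpoint (R : realType) (n : nat) (X : set 'rV[R]_n)
    (psi1 psi2 : 'rV[R]_n -> R) :
    X !=set0 -> compact X ->
    continuous_on X psi1 -> continuous_on X psi2 ->
  exists a b, [/\ X a, X b,
    forall x, X x -> psi1 x - psi2 x <= psi1 a - psi2 a,
    forall x, X x -> psi1 b - psi2 b <= psi1 x - psi2 x &
    shift_const X psi1 psi2 =
      2^-1 * (psi1 a - psi2 a) + 2^-1 * (psi1 b - psi2 b)].
Proof.
move=> X0 cX c1 c2; have cB := within_continuousB c1 c2.
have [a /set_mem Xa maxa] := compact_EVT_max X0 cX cB.
have [b /set_mem Xb minb] := compact_EVT_min X0 cX cB.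
have {}maxa x : X x -> psi1 x - psi2 x <= psi1 a - psi2 a.
  by move=> Xx; apply: maxa; exact: mem_set.
have {}minb x : X x -> psi1 b - psi2 b <= psi1 x - psi2 x.
  by move=> Xx; apply: minb; exact: mem_set.
exists a, b; split=> //; congr (_ * _ + _ * _).
- by apply: set_maxE => [|_ [x Xx <-]]; [exists a | exact: maxa].
- by apply: set_minE => [|_ [x Xx <-]]; [exists b | exact: minb].
Qed.

(** A function bounded above by the midpoint of its range is constant: at a
    maximum point the bound reads max <= (max + min) / 2, so max <= min. *)
Lemma le_shift_const_eq (R : realType) (n : nat) (X : set 'rV[R]_n)
    (psi1 psi2 : 'rV[R]_n -> R) :
    X !=set0 -> compact X ->
    continuous_on X psi1 -> continuous_on X psi2 ->
    (forall x, X x -> psi1 x - psi2 x <= shift_const X psi1 psi2) ->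
  forall x, X x -> psi1 x - psi2 x = shift_const X psi1 psi2.
Proof.
move=> X0 cX c1 c2 le_c x Xx.
have [a [b [Xa _ maxa minb cE]]] := shift_const_midpoint X0 cX c1 c2.
by move: (le_c a Xa) (maxa x Xx) (minb x Xx); rewrite cE; lra.
Qed.

(** The dual fact, read off at a minimum point. *)
Lemma ge_shift_const_eq (R : realType) (n : nat) (X : set 'rV[R]_n)
    (psi1 psi2 : 'rV[R]_n -> R) :
    X !=set0 -> compact X ->
    continuous_on X psi1 -> continuous_on X psi2 ->
    (forall x, X x -> shift_const X psi1 psi2 <= psi1 x - psi2 x) ->
  forall x, X x -> psi1 x - psi2 x = shift_const X psi1 psi2.
Proof.
move=> X0 cX c1 c2 ge_c x Xx.
have [a [b [_ Xb maxa minb cE]]] := shift_const_midpoint X0 cX c1 c2.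
by move: (ge_c b Xb) (maxa x Xx) (minb x Xx); rewrite cE; lra.
Qed.

Lemma shift_const_cst (R : realType) (n : nat) (X : set 'rV[R]_n)
    (psi1 psi2 : 'rV[R]_n -> R) (c : R) :
    X !=set0 ->
    (forall x, X x -> psi1 x - psi2 x = c) ->
  shift_const X psi1 psi2 = c.
Proof.
move=> [x0 Xx0] psi12.
have Ac : [set psi1 x - psi2 x | x in X] c by exists x0 => //; exact: psi12.
rewrite /shift_const (set_maxE (y := c))// ?(set_minE (y := c))//.
- by lra.
- by move=> _ [x Xx <-]; rewrite psi12.
- by move=> _ [x Xx <-]; rewrite psi12.
Qed.

Unset Implicit Arguments.

Theorem proposition3p4 (R : realType) (n m : nat)
    (X : set 'rV[R]_n) (Z : set ('rV[R]_n * 'rV[R]_m))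
    (f : 'rV[R]_n * 'rV[R]_m -> 'rV[R]_n) (l : 'rV[R]_n * 'rV[R]_m -> R)
    (X_nonempty : X !=set0) (X_compact : compact X)
    (Z_sub : Z `<=` X `*` setT) (Z_compact : compact Z)
    (f_maps : set_fun Z X f)
    (f_cont : {within Z, continuous f}) (l_cont : {within Z, continuous l})
    (U_nonempty : forall x, X x -> control_set Z x !=set0)
    (U_usc : upper_semicontinuous_map X (control_set Z))
    (T_cont : forall psi : 'rV[R]_n -> R,
       continuous_on X psi -> continuous_on X (bellman Z f l psi))
    (psi : 'rV[R]_n -> R) (psi_cont : continuous_on X psi) :
  (is_fixed_point X (min_shifted_bellman X Z f l) psi <->
     exists c : R, shifted_bellman_eq X Z f l psi c) /\
  (is_fixed_point X (max_shifted_bellman X Z f l) psi <->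
     exists c : R, shifted_bellman_eq X Z f l psi c).
Proof.
set Tpsi := bellman Z f l psi; set c := shift_const X psi Tpsi.
have cT : continuous_on X Tpsi by exact: T_cont.
have eq_of_cst : (forall x, X x -> psi x - Tpsi x = c) ->
    exists c, shifted_bellman_eq X Z f l psi c.
  by move=> gc; exists (- c) => x Xx; rewrite -/Tpsi -(gc x Xx); lra.
have cst_of_eq : (exists c, shifted_bellman_eq X Z f l psi c) ->
    forall x, X x -> Tpsi x + c = psi x.
  move=> [d Td] x Xx.
  suff -> : c = - d by rewrite /Tpsi Td //; lra.
  by apply: shift_const_cst => // y Xy; rewrite /Tpsi Td //; lra.
split; split.
- move=> fix_psi; apply/eq_of_cst/le_shift_const_eq => // x Xx.
  by move/min_idPl: (fix_psi x Xx); rewrite -/Tpsi -/c; lra.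
- move=> /cst_of_eq Tc x Xx.
  by rewrite /min_shifted_bellman -/Tpsi -/c Tc // minxx.
- move=> fix_psi; apply/eq_of_cst/ge_shift_const_eq => // x Xx.
  by move/max_idPl: (fix_psi x Xx); rewrite -/Tpsi -/c; lra.
- move=> /cst_of_eq Tc x Xx.
  by rewrite /max_shifted_bellman -/Tpsi -/c Tc // maxxx.
Qed.
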